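(* Let $N \geq 1$ and let $L$ be the $N$-periodic Jacobi operator with complex coefficients $a(n)$, $b(n)$, where $a(n) \neq 0$ for all $n$ and $\prod_{j=1}^N a(j) = (-1)^N$. Suppose that $\sigma(L) = [-2,2]$ and that the $2N \times 2N$ matrix $L_{2N}$ of $L|_{\mathcal{P}_{2N}}$ is diagonalizable (i.e. it has $2N$ linearly independent eigenvectors). Then: (i) If $N$ is odd, then $b(n) = 0$ and $a(n)^2 = 1$ for all $n \in \mathbb{Z}$. (ii) If $N$ is even, say $N = 2M$, then $b(n) = 0$ for all $n \in \mathbb{Z}$ and there is $s \in \mathbb{C}$ such that $a(n)^2 = 1 + (-1)^n s$ for all $n \in \mathbb{Z}$, where $s^2 = 1 - e^{2k\pi i/M}$ for some $k \in \{0, 1, \ldots, M-1\}$.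
   Context: The functions $a, b : \mathbb{Z} \to \mathbb{C}$ are $N$-periodic: $a(n+N) = a(n)$, $b(n+N) = b(n)$. The Jacobi operator $L$ is $$(Lw)(n) := a(n) w(n+1) + a(n-1) w(n-1) + b(n) w(n), \qquad n \in \mathbb{Z},$$ and $\sigma(L) \subset \mathbb{C}$ is its spectrum as a bounded operator on $l^2(\mathbb{Z})$. For $m \geq 1$, $\mathcal{P}_m$ is the $m$-dimensional complex vector space of $m$-periodic sequences $f : \mathbb{Z} \to \mathbb{C}$, $f(n+m) = f(n)$. The formula for $L$ maps $\mathcal{P}_{2N}$ into itself, and $L_{2N}$ denotes the matrix of $L|_{\mathcal{P}_{2N}}$ with respect to the basis $e_1, \ldots, e_{2N}$, where $e_j$ is the $2N$-periodic sequence with $e_j(n) = \delta_{jn}$ for $n = 1, \ldots, 2N$. (For $N \geq 2$, $L_{2N}$ is the symmetric matrix with diagonal entries $b(1), \ldots, b(2N)$, entries $a(1), \ldots, a(2N-1)$ on the super- and sub-diagonals, $a(2N)$ in the $(1,2N)$ and $(2N,1)$ corners, and zeros elsewhere.) *)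

(* Defs.v *)
From HB Require Import structures.
From mathcomp Require Import all_boot all_order all_algebra.
From mathcomp Require Import all_classical all_reals all_analysis.
From mathcomp Require Import complex.

Set Implicit Arguments.
Unset Strict Implicit.
Unset Printing Implicit Defensive.
Import Order.TTheory GRing.Theory Num.Theory.

Local Open Scope classical_set_scope.
Local Open Scope complex_scope.
Local Open Scope ring_scope.

Definition jacobi (R : realType) (a b w : int -> R[i]) : int -> R[i] :=
  fun n => a n * w (n + 1) + a (n - 1) * w (n - 1) + b n * w n.

Definition l2_sqsum (R : realType) (f : int -> R[i]) : \bar R :=
  (\esum_(n in [set: int]) (Normc.normc (f n) ^+ 2)%:E).

Definition l2 (R : realType) : set (int -> R[i]) :=
  [set f | (l2_sqsum f < +oo)%E].

Definition l2_norm (R : realType) (f : int -> R[i]) : R :=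
  Num.sqrt (fine (l2_sqsum f)).

(* An operator on l^2(Z) is represented by a map on all sequences; its values
   outside l^2(Z) are irrelevant. *)
Definition l2_bounded_operator (R : realType)
    (T : (int -> R[i]) -> (int -> R[i])) : Prop :=
  [/\ forall f, l2 f -> l2 (T f),
      forall (c : R[i]) f g, l2 f -> l2 g ->
        T (fun n => c * f n + g n) = (fun n => c * T f n + T g n)
    & exists K : R, forall f, l2 f -> l2_norm (T f) <= K * l2_norm f].

Definition l2_resolvent_set (R : realType)
    (T : (int -> R[i]) -> (int -> R[i])) : set R[i] :=
  [set z | exists S : (int -> R[i]) -> (int -> R[i]),
     l2_bounded_operator S /\
     forall f, l2 f ->
       S (fun n => T f n - z * f n) = f /\
       (fun n => T (S f) n - z * S f n) = f].

Definition l2_spectrum (R : realType)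
    (T : (int -> R[i]) -> (int -> R[i])) : set R[i] :=
  ~` l2_resolvent_set T.

(* The ordinal j stands for the index j + 1 in 1, ..., m. *)
Definition periodic_basis (R : realType) (m : nat) (j : 'I_m) : int -> R[i] :=
  fun n => ((n == j.+1%:Z %[mod m%:Z])%Z)%:R.

(* Column j lists the coordinates f(1), ..., f(m) of f = jacobi a b e_(j+1). *)
Definition jacobi_periodic_mx (R : realType) (a b : int -> R[i]) (m : nat) :
    'M[R[i]]_m :=
  \matrix_(i < m, j < m) jacobi a b (periodic_basis R j) i.+1%:Z.

Definition cexp (R : realType) (z : R[i]) : R[i] :=
  (expR (complex.Re z))%:C * (cos (complex.Im z) +i* sin (complex.Im z)).

(* Main.v *)
(* Let T_k be the Chebyshev polynomials normalized by T_k(2 cos t) = 2 cos (k t),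
   let S be the shift by N on 2N-periodic sequences, and write J for L_2N.
   Eigenvectors of J are bounded solutions of L f = z f, so that truncating them
   shows that the eigenvalues of J belong to sigma(L) = [-2, 2].  Since J and S
   commute, they have a common eigenbasis, with eigenvalues d_i and e_i = 1 or -1.
   T_N(L) has bandwidth N with the products of N consecutive a's as outermost
   coefficients, so tr (T_N(J) S) = 4N (-1)^N.  This is also the sum of the 2N
   numbers T_N(d_i) e_i, which have modulus at most 2; hence
   T_N(d_i) = 2 (-1)^N e_i, and then T_(N-1)(d_i) = (-1)^N e_i d_i, which means
   T_(N-1)(J) = (-1)^N S J.  Comparing coefficients in this identity gives b = 0
   and, together with the value of the product of the a's, a(n)^2 = 1.  In
   particular (ii) always holds with s = 0 and k = 0. *)

Require Import Defs.
From mathcomp Require Import all_boot all_order all_algebra.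
From mathcomp Require Import all_classical all_reals all_analysis.
From mathcomp Require Import complex.
From mathcomp Require Import zify ring lra.

Set Implicit Arguments.
Unset Strict Implicit.
Unset Printing Implicit Defensive.
Import Order.TTheory GRing.Theory Num.Theory.

Local Open Scope classical_set_scope.
Local Open Scope complex_scope.
Local Open Scope ring_scope.

(** * Chebyshev polynomials of scalars and operators *)

(** This is T_k(A) v, with T_0 = 2. Taking an arbitrary map on an additive group lets one recursion
    serve real and complex scalars, matrices and sequences; [cheb_morph] passes between them. *)
Fixpoint cheb (V : zmodType) (A : V -> V) (k : nat) (v : V) : V :=
  if k is k'.+1 then
    if k' is k''.+1 then A (cheb A k' v) - cheb A k'' v else A v
  else v + v.

Lemma chebSS (V : zmodType) (A : V -> V) k v :
  cheb A k.+2 v = A (cheb A k.+1 v) - cheb A k v.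
Proof. by []. Qed.

Lemma nat_ind2 (P : nat -> Prop) :
  P 0%N -> P 1%N -> (forall k, P k -> P k.+1 -> P k.+2) -> forall k, P k.
Proof.
by move=> P0 P1 PSS k; suff [] : P k /\ P k.+1; elim: k => // k [? ?]; split; auto.
Qed.

Lemma cheb_morph (U V : zmodType) (A : U -> U) (B : V -> V) (phi : U -> V) :
  {morph phi : x y / x - y} -> (forall x, phi (A x) = B (phi x)) ->
  forall k x, phi (cheb A k x) = cheb B k (phi x).
Proof.
move=> phiB phiA k x; elim/nat_ind2: k => [||k IH0 IH1]; last first.
- by rewrite !chebSS phiB phiA IH0 IH1.
- exact: phiA.
have phi0 : phi 0 = 0 by rewrite -(subr0 0) phiB subrr.
have phiN y : phi (- y) = - phi y by rewrite -(sub0r y) phiB phi0 sub0r.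
by rewrite /= -{2}(opprK x) phiB phiN opprK.
Qed.

Lemma cheb_cos (R : realType) (t : R) k :
  cheb ( *%R (2 * cos t)) k 1 = 2 * cos (k%:R * t).
Proof.
elim/nat_ind2: k => [||k IH0 IH1].
- by rewrite /= mul0r cos0; ring.
- by rewrite /= mul1r mulr1.
have -> : k.+2%:R * t = k.+1%:R * t + t by rewrite -(natr1 k.+1); ring.
have e : k%:R * t = k.+1%:R * t - t by rewrite -natr1; ring.
rewrite chebSS IH1 IH0 e cosB cosD; ring.
Qed.

Lemma interval_cos (R : realType) (x : R) :
  x \in `[-2, 2] -> exists t, x = 2 * cos t.
Proof.
rewrite in_itv /= => /andP[x1 x2]; exists (acos (x / 2)).
by rewrite acosK ?in_itv /=; lra.
Qed.

Lemma cheb_le2 (R : realType) (x : R) k :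
  x \in `[-2, 2] -> `|cheb ( *%R x) k 1| <= 2.
Proof.
move=> /interval_cos[t ->]; rewrite cheb_cos normrM normr_nat.
by have := cos_max (k%:R * t); lra.
Qed.

(** Writing x = 2 cos t, the value 2s forces cos((k+1)t) = s with s^2 = 1, so sin((k+1)t) = 0, and
    expanding cos((k+1)t - t) leaves only s cos t. *)
Lemma cheb_extremal (R : realType) (x s : R) k :
  x \in `[-2, 2] -> s ^+ 2 = 1 -> cheb ( *%R x) k.+1 1 = 2 * s ->
  cheb ( *%R x) k 1 = s * x.
Proof.
move=> /interval_cos[t ->] s1; rewrite !cheb_cos => /(mulfI _) h.
have cosk : cos (k.+1%:R * t) = s by apply: h; lra.
have sink : sin (k.+1%:R * t) = 0.
  by apply/eqP; rewrite -sqrf_eq0; apply/eqP; rewrite sin2cos2 cosk s1 subrr.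
have -> : k%:R * t = k.+1%:R * t - t by rewrite -natr1; ring.
by rewrite cosB cosk sink; ring.
Qed.

Lemma jacobiE (R : realType) (a b w : int -> R[i]) n :
  jacobi a b w n = a n * w (n + 1) + a (n - 1) * w (n - 1) + b n * w n.
Proof. by []. Qed.

(** Only the two extreme paths, straight right and straight left from n, reach a site where w may be
    nonzero; each contributes the product of the coefficients it crosses. For k = 0 both paths are
    trivial and give 2 w(n), in agreement with T_0 = 2. *)
Lemma cheb_jacobi_band (R : realType) (a b w : int -> R[i]) (k : nat) (n : int) :
  (forall m : int, (`|m - n| < k%:Z)%R -> w m = 0) ->
  cheb (jacobi a b) k w n =
    (\prod_(j < k) a (n + j%:Z)) * w (n + k%:Z)
    + (\prod_(j < k) a (n - 1 - j%:Z)) * w (n - k%:Z).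
Proof.
elim/nat_ind2: k n => [||k IH0 IH1] n w0.
- by rewrite !big_ord0 !mul1r addr0.
- rewrite !big_ord1 /= /jacobi (w0 n) ?subrr // mulr0 addr0.
  have -> : n + 0%:Z = n by lia.
  by have -> : n - 1 - 0%:Z = n - 1 by lia.
have z (m : int) : (`|m - n| <= k.+1%:Z)%R -> w m = 0 by move=> ?; apply: w0; lia.
rewrite (_ : cheb _ _ _ _ = jacobi a b (cheb (jacobi a b) k.+1 w) n
    - cheb (jacobi a b) k w n) //.
rewrite jacobiE IH0 ?IH1; try by move=> *; apply: z; lia.
(* Among the sites produced by the recursion only n + k + 2 and n - k - 2 lie outside the radius k +
   1 where w vanishes. *)
rewrite [w (n + k.+1%:Z)]z 1?[w (n - k.+1%:Z)]z 1?[w (n + k%:Z)]z; try lia.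
rewrite [w (n - k%:Z)]z 1?[w (n + 1 - k.+1%:Z)]z; try lia.
rewrite [w (n - 1 + k.+1%:Z)]z; last by lia.
rewrite !mulr0 !addr0 add0r subr0.
rewrite [in RHS]big_ord_recl [in RHS](big_ord_recl k.+1 (fun j => a (n - 1 - _))) /=.
rewrite mulr0 addr0 !mulrA; congr (_ * _ + _ * _).
- congr (_ * _); first by congr a; lia.
  by apply: eq_bigr => i _; rewrite /bump /=; congr a; lia.
- congr w; lia.
- congr (_ * _); first by congr a; lia.
  by apply: eq_bigr => i _; rewrite /bump /=; congr a; lia.
- congr w; lia.
Qed.

(** * Periodic sequences and their coordinate vectors *)

Lemma periodicz (V : zmodType) (f : int -> V) (T : int) :
  periodic f T -> forall k n, f (n + k * T) = f n.
Proof.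
move=> fT k n; case: (intP k) => [|{}k|{}k].
- by rewrite mul0r addr0.
- by rewrite -natz mulr_natl periodicn.
- rewrite -[in RHS](subrK (k.+1%:Z * T) n) mulNr.
  by rewrite -natz mulr_natl periodicn.
Qed.

Lemma succ_representative (m : nat) (n : int) : (0 < m)%N ->
  exists j : 'I_m, (m%:Z %| n - j.+1%:Z)%Z.
Proof.
move=> m0.
(* Reducing n - 1 rather than n matches the convention that the ordinal j stands for the site j +
   1. *)
have r0 : (0 <= (n - 1) %% m%:Z)%Z by apply: modz_ge0; lia.
have rm : ((n - 1) %% m%:Z < m%:Z)%Z by apply: ltz_pmod; lia.
have hi : (`|((n - 1) %% m%:Z)%Z|%N < m)%N by lia.
exists (Ordinal hi); apply/dvdzP; exists ((n - 1) %/ m%:Z)%Z.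
by have := divz_eq (n - 1) m%:Z; rewrite /=; lia.
Qed.

Lemma eq_periodic (V : zmodType) (m : nat) (f g : int -> V) : (0 < m)%N ->
  periodic f m%:Z -> periodic g m%:Z ->
  (forall i : 'I_m, f i.+1%:Z = g i.+1%:Z) -> f = g.
Proof.
move=> m0 fm gm fg; apply/funext => n.
have [j /dvdzP[q nE]] := succ_representative n m0.
by rewrite -(subrK j.+1%:Z n) nE addrC !periodicz.
Qed.

Lemma periodic_basis_periodic (R : realType) (m : nat) (j : 'I_m) :
  periodic (periodic_basis R j) m%:Z.
Proof. by move=> n; rewrite /periodic_basis modzDr. Qed.

Lemma periodic_basis1 (R : realType) (m : nat) (j : 'I_m) (n : int) :
  (m%:Z %| n - j.+1%:Z)%Z -> periodic_basis R j n = 1.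
Proof. by rewrite -eqz_mod_dvd /periodic_basis => ->. Qed.

Lemma periodic_basis0 (R : realType) (m : nat) (j : 'I_m) (n : int) :
  ~~ (m%:Z %| n - j.+1%:Z)%Z -> periodic_basis R j n = 0.
Proof. by rewrite -eqz_mod_dvd /periodic_basis => /negbTE->. Qed.

Lemma ndvdz_small (m : nat) (n : int) : n != 0 -> `|n| < m%:Z -> ~~ (m%:Z %| n)%Z.
Proof.
move=> n0 nm; apply/negP => /dvdzP[q qE]; move: n0 nm; rewrite qE => *.
have : q != 0 by lia.
nia.
Qed.

Definition seq_of (R : realType) (m : nat) (v : 'cV[R[i]]_m) : int -> R[i] :=
  fun n => \sum_j v j 0 * periodic_basis R j n.

Lemma seq_of_succ (R : realType) (m : nat) (v : 'cV[R[i]]_m) (i : 'I_m) :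
  seq_of v i.+1%:Z = v i 0.
Proof.
rewrite /seq_of (bigD1 i) //= periodic_basis1 ?subrr ?dvdz0 // mulr1.
rewrite big1 ?addr0 // => j ji; rewrite periodic_basis0 ?mulr0 //.
apply: ndvdz_small; last by have := ltn_ord i; have := ltn_ord j; lia.
by move: ji; rewrite -val_eqE /=; lia.
Qed.

Lemma seq_of_periodic (R : realType) (m : nat) (v : 'cV[R[i]]_m) :
  periodic (seq_of v) m%:Z.
Proof. by move=> n; apply: eq_bigr => j _; rewrite periodic_basis_periodic. Qed.

Lemma seq_of_delta (R : realType) (m : nat) (j : 'I_m) :
  seq_of (delta_mx j 0 : 'cV[R[i]]_m) = periodic_basis R j.
Proof.
apply/funext => n; rewrite /seq_of (bigD1 j) //= mxE !eqxx mul1r.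
by rewrite big1 ?addr0 // => k kj; rewrite mxE (negbTE kj) mul0r.
Qed.

Lemma seq_ofB (R : realType) (m : nat) :
  {morph @seq_of R m : u v / u - v}.
Proof.
move=> u v; apply/funext => n; rewrite -[RHS]/(seq_of u n - seq_of v n) /seq_of -sumrB.
by apply: eq_bigr => j _; rewrite !mxE mulrBl.
Qed.

(** Both sides are m-periodic, so they need only agree at 1, ..., m, where linearity reduces the
    claim to the matrix entries. This serves both the Jacobi operator and the shift. *)
Lemma seq_of_mulmx (R : realType) (m : nat) (W : (int -> R[i]) -> int -> R[i])
    (v : 'cV[R[i]]_m) : (0 < m)%N ->
  (forall f, periodic f m%:Z -> periodic (W f) m%:Z) ->
  (forall (v : 'cV[R[i]]_m) n,
    W (seq_of v) n = \sum_j v j 0 * W (periodic_basis R j) n) ->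
  seq_of ((\matrix_(i < m, j < m) W (periodic_basis R j) i.+1%:Z) *m v)
    = W (seq_of v).
Proof.
move=> m0 Wper Wlin; apply: (@eq_periodic _ m) => //.
- exact: seq_of_periodic.
- exact/Wper/seq_of_periodic.
move=> i; rewrite seq_of_succ Wlin mxE; apply: eq_bigr => j _.
by rewrite mxE mulrC.
Qed.

Lemma seq_ofZ (R : realType) (m : nat) c (v : 'cV[R[i]]_m) :
  seq_of (c *: v) = fun n => c * seq_of v n.
Proof.
apply/funext => n; rewrite /seq_of mulr_sumr.
by apply: eq_bigr => j _; rewrite mxE mulrA.
Qed.

Lemma jacobi_periodic (R : realType) (a b f : int -> R[i]) (m : int) :
  periodic a m -> periodic b m -> periodic f m -> periodic (jacobi a b f) m.
Proof.
move=> am bm fm n; rewrite !jacobiE am bm fm (addrAC n m 1) fm.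
by rewrite (addrAC n m (-1)) am fm.
Qed.

Lemma seq_of_jacobi (R : realType) (a b : int -> R[i]) (m : nat)
    (v : 'cV[R[i]]_m) : (0 < m)%N -> periodic a m%:Z -> periodic b m%:Z ->
  seq_of (jacobi_periodic_mx a b m *m v) = jacobi a b (seq_of v).
Proof.
move=> m0 am bm; apply: seq_of_mulmx => // [f|{}v n]; first exact: jacobi_periodic.
rewrite jacobiE /seq_of !mulr_sumr -!big_split /=.
by apply: eq_bigr => j _; rewrite jacobiE; ring.
Qed.

Definition shift_mx (R : realType) (N m : nat) : 'M[R[i]]_m :=
  \matrix_(i < m, j < m) periodic_basis R j (i.+1%:Z + N%:Z).

Lemma seq_of_shift (R : realType) (N m : nat) (v : 'cV[R[i]]_m) : (0 < m)%N ->
  seq_of (shift_mx R N m *m v) = fun n => seq_of v (n + N%:Z).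
Proof.
move=> m0; apply: (@seq_of_mulmx _ _ (fun f n => f (n + N%:Z))) => // f fm n.
by rewrite addrAC fm.
Qed.

(** * Truncated periodic eigenvectors and the spectrum *)

Lemma l2_sqsum_finite (R : realType) (f : int -> R[i]) (s : seq int) :
  uniq s -> (forall n, n \notin s -> f n = 0) ->
  l2_sqsum f = (\sum_(n <- s) Normc.normc (f n) ^+ 2)%:E.
Proof.
move=> us fs; rewrite -sumEFin fsbig_seq // -esum_fset //; last first.
  by move=> *; rewrite lee_fin sqr_ge0.
rewrite esum_mkcond; apply: eq_esum => n _; case: ifPn => //.
rewrite notin_setE /= => /negP /fs ->.
by rewrite Normc.normc0 expr0n.
Qed.

Lemma l2_norm_finite (R : realType) (f : int -> R[i]) (s : seq int) :
  uniq s -> (forall n, n \notin s -> f n = 0) ->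
  l2_norm f ^+ 2 = \sum_(n <- s) Normc.normc (f n) ^+ 2.
Proof.
move=> us fs; rewrite /l2_norm (l2_sqsum_finite us fs) sqr_sqrtr //=.
by apply: sumr_ge0 => *; rewrite sqr_ge0.
Qed.

Lemma l2_finite (R : realType) (f : int -> R[i]) (s : seq int) :
  uniq s -> (forall n, n \notin s -> f n = 0) -> l2 f.
Proof. by move=> us fs; rewrite /l2 /= (l2_sqsum_finite us fs) ltry. Qed.

Definition truncate (R : realType) (p : nat) (f : int -> R[i]) : int -> R[i] :=
  fun n => if (0 <= n < p%:Z) then f n else 0.

Lemma truncate_l2 (R : realType) (p : nat) (f : int -> R[i]) :
  l2 (truncate p f) /\
  l2_norm (truncate p f) ^+ 2 = \sum_(0 <= n < p) Normc.normc (f n%:Z) ^+ 2.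
Proof.
have us : uniq [seq n%:Z | n <- index_iota 0 p].
  by rewrite map_inj_uniq ?iota_uniq // => ? ? [].
have fs n : n \notin [seq n%:Z | n <- index_iota 0 p] -> truncate p f n = 0.
  move=> h; rewrite /truncate; case: ifP => // /andP[n0 np]; case/negP: h.
  by apply/mapP; exists `|n|%N; [rewrite mem_index_iota; lia | lia].
split; first exact: l2_finite us fs.
rewrite (l2_norm_finite us fs) big_map; apply: eq_big_nat => n /andP[_ np].
by rewrite /truncate ifT //; lia.
Qed.

(** The eigenvalue equation fails only where L couples across an edge of the window 0, ..., p - 1,
    that is at -1, 0, p - 1 and p; these sites are distinct because p > 1. *)
Lemma jacobi_truncate (R : realType) (a b f : int -> R[i]) (z : R[i]) (p : nat) :
  (1 < p)%N -> jacobi a b f = (fun n => z * f n) ->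
  let g := fun n => jacobi a b (truncate p f) n - z * truncate p f n in
  l2 g /\ l2_norm g ^+ 2 =
    Normc.normc (a (-1) * f 0) ^+ 2 + Normc.normc (a (-1) * f (-1)) ^+ 2
    + Normc.normc (a (p%:Z - 1) * f p%:Z) ^+ 2
    + Normc.normc (a (p%:Z - 1) * f (p%:Z - 1)) ^+ 2.
Proof.
move=> p1 fz g.
have fE n : z * f n = a n * f (n + 1) + a (n - 1) * f (n - 1) + b n * f n.
  by rewrite -jacobiE fz.
have us : uniq [:: -1; 0; p%:Z - 1; p%:Z].
  by rewrite /= !inE; lia.
have gs n : n \notin [:: -1; 0; p%:Z - 1; p%:Z] -> g n = 0.
  rewrite !inE /g jacobiE /truncate => h.
  have [np|np] := boolP (0 <= n < p%:Z).
    by rewrite !ifT ?fE ?subrr //; lia.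
  by rewrite !ifF; first (by rewrite !mulr0 !addr0 subrr); lia.
split; first exact: l2_finite us gs.
rewrite (l2_norm_finite us gs) !big_cons big_nil addr0 !addrA.
have nN (x : R[i]) : Normc.normc (- x) = Normc.normc x by exact: normcN.
rewrite -(nN (a (-1) * f (-1))) -(nN (a (p%:Z - 1) * f p%:Z)).
have tin n : 0 <= n < p%:Z -> truncate p f n = f n.
  by rewrite /truncate => ->.
have tout n : ~~ (0 <= n < p%:Z) -> truncate p f n = 0.
  by rewrite /truncate => /negbTE->.
congr (_ ^+ 2 + _ ^+ 2 + _ ^+ 2 + _ ^+ 2); congr Normc.normc; rewrite /g jacobiE.
- rewrite (tout (-1)) ?(tout (-1 - 1)) ?(tin (-1 + 1)); try lia.
  by rewrite !mulr0 !addr0 subr0.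
- rewrite (tout (0 - 1)) ?(tin 0) ?(tin (0 + 1)) ?fE ?sub0r; try lia.
  ring.
- rewrite (tout (p%:Z - 1 + 1)) ?(tin (p%:Z - 1)) ?(tin (p%:Z - 1 - 1)) ?fE ?subrK; try lia.
  ring.
- rewrite (tout p%:Z) ?(tout (p%:Z + 1)) ?(tin (p%:Z - 1)); try lia.
  ring.
Qed.

(** A bounded resolvent would bound the truncation of f by a constant times its residual. Over J
    periods the squared norm of the truncation is J c with c > 0, while the residual has squared
    norm V independent of J. *)
Lemma periodic_eigen_spectrum (R : realType) (a b f : int -> R[i]) (m : nat)
    (z : R[i]) (k : int) : (0 < m)%N ->
  periodic a m%:Z -> periodic f m%:Z -> f k != 0 ->
  jacobi a b f = (fun n => z * f n) -> l2_spectrum (jacobi a b) z.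
Proof.
move=> m0 am fm fk fz [S [[Sl2 _ [K SK]] Sinv]].
have [n0 f0] : exists n0 : 'I_m, f n0%:Z != 0.
  have r0 : (0 <= k %% m%:Z)%Z by apply: modz_ge0; lia.
  have rm : (k %% m%:Z < m%:Z)%Z by apply: ltz_pmod; lia.
  have hi : (`|(k %% m%:Z)%Z|%N < m)%N by lia.
  exists (Ordinal hi); rewrite /= gez0_abs //.
  by move: fk; rewrite {1}(divz_eq k m%:Z) addrC periodicz.
pose c := \sum_(0 <= n < m) Normc.normc (f n%:Z) ^+ 2.
(* For windows of whole periods the two right-edge terms are equal to the left-edge ones, hence the
   repetition. *)
pose V := Normc.normc (a (-1) * f 0) ^+ 2 + Normc.normc (a (-1) * f (-1)) ^+ 2
  + Normc.normc (a (-1) * f 0) ^+ 2 + Normc.normc (a (-1) * f (-1)) ^+ 2.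
have c0 : 0 < c.
  rewrite /c big_mkord (bigD1 n0) //= ltr_pwDl //.
    rewrite lt0r sqr_ge0 sqrf_eq0 andbT.
    by apply: contra f0 => /eqP /Normc.eq0_normc ->.
  by apply: sumr_ge0 => *; rewrite sqr_ge0.
suff bnd J : (1 < J)%N -> J%:R * c <= K ^+ 2 * V.
  (* J exceeds K^2 V / c by the Archimedean property; the added 2 also ensures J > 1. *)
  pose J := (Num.bound (K ^+ 2 * V / c)).+2.
  have := bnd J isT; rewrite leNgt => /negP; apply.
  rewrite -ltr_pdivrMr //; apply: lt_trans (archi_boundP _) _; last by rewrite ltr_nat.
  have V0 : 0 <= V by rewrite /V !addr_ge0 ?sqr_ge0.
  by apply: divr_ge0; [rewrite mulr_ge0 ?sqr_ge0 | exact: ltW].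
move=> J1; pose p := (J * m)%N.
have p1 : (1 < p)%N by rewrite /p; nia.
have [fl2 fn] := truncate_l2 p f.
have [gl2 gn] := jacobi_truncate p1 fz.
have [Sg _] := Sinv _ fl2.
have := SK _ gl2; rewrite Sg => le.
have /(lerXn2r 2) : l2_norm (truncate p f) \is Num.nneg by rewrite nnegrE sqrtr_ge0.
move=> /(_ _ _ le); rewrite nnegrE (le_trans _ le) ?sqrtr_ge0 // => /(_ isT).
rewrite exprMn fn gn.
have pE n : f (n + p%:Z) = f n by rewrite /p PoszM periodicz.
have paE n : a (n + p%:Z) = a n by rewrite /p PoszM periodicz.
rewrite -[p%:Z]add0r pE add0r [p%:Z - 1]addrC pE paE => le2.
apply: le_trans le2; rewrite big_nat_mul.
rewrite (eq_big_nat _ _ (F2 := fun=> c)); last first.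
  move=> i _; rewrite -[(i * m)%N]add0n big_addn mulSn addnK.
  by apply: eq_big_nat => n _; rewrite PoszD PoszM periodicz.
by rewrite big_const_nat iter_addr_0 subn0 mulr_natl.
Qed.

(** * Simultaneous diagonalization of J and the shift *)

Lemma involution_diagonalizable (F : fieldType) n (S : 'M[F]_n) :
  2 != 0 :> F -> S *m S = 1%:M -> diagonalizable S.
Proof.
move=> F2 SS; apply/diagonalizablePeigen; exists [:: 1; -1].
  rewrite /= inE andbT; apply: contra F2 => /eqP h.
  by rewrite -[2]/(1 + 1) {2}h subrr.
rewrite !big_cons big_nil; apply/eqmxP; rewrite submx1 /=.
(* The two halves of this splitting of the identity land in the eigenspaces of S for 1 and -1. *)
have -> : 1%:M = 2^-1 *: (1%:M + S) + 2^-1 *: (1%:M - S).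
  by rewrite -scalerDr addrACA subrr addr0 -mulr2n -scaler_nat scalerA mulVf ?scale1r.
apply: addmx_sub_adds; first apply/eigenspaceP.
  by rewrite -scalemxAl mulmxDl mul1mx SS scale1r addrC.
apply: submx_trans (addsmxSl _ _); apply/eigenspaceP.
by rewrite -scalemxAl mulmxBl mul1mx SS scaleN1r -scalerN opprB.
Qed.

Lemma mulmx_inj_col (R : nzRingType) m n (A B : 'M[R]_(m, n)) :
  (forall v : 'cV_n, A *m v = B *m v) -> A = B.
Proof.
move=> AB; apply/matrixP => i j.
by have /matrixP/(_ i 0) := AB (delta_mx j 0); rewrite -!colE !mxE.
Qed.

Lemma eq_seq_of_mulmx (R : realType) (m : nat) (A B : 'M[R[i]]_m) :
  (forall v : 'cV_m, seq_of (A *m v) = seq_of (B *m v)) -> A = B.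
Proof.
move=> AB; apply: mulmx_inj_col => v; apply/colP => i.
by rewrite -!seq_of_succ AB.
Qed.

Section Eigenbasis.
Variables (R : realType) (N : nat) (a b : int -> R[i]).
Hypotheses (hN : (0 < N)%N) (ha : periodic a N%:Z) (hb : periodic b N%:Z).

Let m := (2 * N)%N.
Let J := jacobi_periodic_mx a b m.
Let S := shift_mx R N m.

Let m0 : (0 < m)%N. Proof. by rewrite /m muln_gt0. Qed.

Let periodic_double (f : int -> R[i]) : periodic f N%:Z -> periodic f m%:Z.
Proof. by move=> fN n; rewrite /m PoszM periodicz. Qed.

Let seq_of_J v : seq_of (J *m v) = jacobi a b (seq_of v).
Proof. by apply: seq_of_jacobi => //; exact: periodic_double. Qed.

Let seq_of_S v : seq_of (S *m v) = fun n => seq_of v (n + N%:Z).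
Proof. exact: seq_of_shift. Qed.

Lemma shift_mx_involutive : S *m S = 1%:M.
Proof.
apply: eq_seq_of_mulmx => v; rewrite -mulmxA mul1mx !seq_of_S.
apply/funext => n; rewrite -addrA (_ : N%:Z + N%:Z = m%:Z); last by rewrite /m; lia.
exact: seq_of_periodic.
Qed.

Lemma jacobi_shift_comm : J *m S = S *m J.
Proof.
apply: eq_seq_of_mulmx => v; rewrite -!mulmxA seq_of_J !seq_of_S seq_of_J.
apply/funext => n; rewrite !jacobiE ha hb (addrAC n N%:Z 1) (addrAC n N%:Z (-1)).
by rewrite ha.
Qed.

Lemma cheb_mxE k v :
  seq_of (cheb (mulmx J) k 1%:M *m v) = cheb (jacobi a b) k (seq_of v).
Proof.
rewrite (cheb_morph (phi := fun X => seq_of (X *m v)) (B := jacobi a b)) ?mul1mx //.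
- by move=> X Y; rewrite mulmxBl seq_ofB.
- by move=> X; rewrite -mulmxA seq_of_J.
Qed.

Lemma cheb_row (p : 'rV[R[i]]_m) d k :
  p *m J = d *: p -> p *m cheb (mulmx J) k 1%:M = cheb ( *%R d) k 1 *: p.
Proof.
move=> pJ.
rewrite (cheb_morph (phi := mulmx p) (B := *:%R d)); first last.
- by move=> X; rewrite mulmxA pJ scalemxAl.
- by move=> X Y; rewrite mulmxBr.
rewrite (cheb_morph (phi := fun c => c *: p) (B := *:%R d)) ?mulmx1 ?scale1r //.
- by move=> c c'; rewrite scalerBl.
- by move=> c; rewrite scalerA.
Qed.

(** Commuting diagonalizable matrices are codiagonalizable. The rows of P are left eigenvectors,
    which is what the trace computation uses; the columns of its inverse are right eigenvectors,
    which correspond to solutions of L f = z f. *)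
Lemma jacobi_shift_eigenbasis : diagonalizable J ->
  exists (P : 'M[R[i]]_m) (d e : 'I_m -> R[i]),
  [/\ P \in unitmx, forall i, row i P *m J = d i *: row i P,
    forall i, row i P *m S = e i *: row i P, forall i, e i ^+ 2 = 1 &
    forall i, J *m col i (invmx P) = d i *: col i (invmx P)].
Proof.
move=> diagJ; have diagS : diagonalizable S.
  by apply: involution_diagonalizable shift_mx_involutive; rewrite pnatr_eq0.
have [P Pu /= /and3P[/similar_diagPex[d PJ] /similar_diagPex[e PS] _]] :
    codiagonalizable [:: J; S].
  apply/codiagonalizableP; split=> [A B|A]; rewrite !inE; last by case/orP => /eqP->.
  by do 2!(case/orP => /eqP->); rewrite /comm_mx // jacobi_shift_comm.
move: PJ PS => /(similarP Pu) PJ /(similarP Pu) PS.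
have rowJ i : row i P *m J = d 0 i *: row i P.
  by rewrite -row_mul PJ row_mul row_diag_mx -scalemxAl -rowE.
have rowS i : row i P *m S = e 0 i *: row i P.
  by rewrite -row_mul PS row_mul row_diag_mx -scalemxAl -rowE.
exists P, (d 0), (e 0); split => // i.
- have : row i P *m S *m S = row i P by rewrite -mulmxA shift_mx_involutive mulmx1.
  rewrite rowS -scalemxAl rowS scalerA -expr2 => /eqP.
  rewrite -[X in _ == X]scale1r -subr_eq0 -scalerBl scaler_eq0 subr_eq0.
  case/orP => [/eqP//|/eqP Pi0].
  have /matrixP/(_ 0 i)/eqP : row i 1%:M = 0 :> 'rV[R[i]]_m.
    by rewrite -(mulmxV Pu) row_mul Pi0 mul0mx.
  by rewrite !mxE eqxx oner_eq0.
- have JQ : J *m invmx P = invmx P *m diag_mx d.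
    by rewrite -[LHS](mulKmx Pu) !mulmxA -(mulmxA _ P) PJ -!mulmxA mulmxV // mulmx1.
  by rewrite {1}colE mulmxA JQ -colE; apply/colP => k; rewrite mul_mx_diag !mxE mulrC.
Qed.

(** * Products over a period and the trace of T_N(J) S *)

Hypothesis ha0 : forall n : int, a n != 0.
Hypothesis hprod : \prod_(1 <= j < N.+1) a j%:Z = (-1) ^+ N.

(** Moving the window one site drops a(k) and gains a(k + N) = a(k), so the product does not depend
    on its starting point. *)
Lemma prod_period n : \prod_(j < N) a (n + j%:Z) = (-1) ^+ N.
Proof.
have step k : \prod_(j < N) a (k + 1 + j%:Z) = \prod_(j < N) a (k + j%:Z).
  apply: (mulfI (ha0 k)); transitivity (\prod_(j < N.+1) a (k + j%:Z)).
    rewrite big_ord_recl addr0; congr (_ * _); apply: eq_bigr => j _.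
    by congr a; rewrite /= /bump; lia.
  by rewrite big_ord_recr /= ha mulrC.
have := periodicz (f := fun k => \prod_(j < N) a (k + j%:Z)) step (n - 1) 1.
rewrite mulr1 addrC subrK => ->; rewrite -hprod big_add1 big_mkord.
by apply: eq_bigr => j _; congr a; lia.
Qed.

Lemma prod_period_rev n : \prod_(j < N) a (n - 1 - j%:Z) = (-1) ^+ N.
Proof.
rewrite -(prod_period (n - N%:Z)) (reindex_inj rev_ord_inj).
by apply: eq_bigr => j _; congr a; rewrite /=; have := ltn_ord j; lia.
Qed.

(** Shifted by N, a basis sequence of period 2N is supported at distance exactly N on either side of
    its diagonal site, so the band formula applies and both period products contribute (-1)^N. *)
Lemma cheb_shift_trace :
  \tr (cheb (mulmx J) N 1%:M *m S) = \sum_(i < m) 2 * (-1) ^+ N.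
Proof.
apply: eq_bigr => j _.
transitivity ((cheb (mulmx J) N 1%:M *m S *m delta_mx j 0 : 'cV_m) j 0).
  by rewrite -colE !mxE.
rewrite -seq_of_succ -mulmxA cheb_mxE seq_of_S seq_of_delta cheb_jacobi_band => [|k kj].
  rewrite prod_period prod_period_rev !periodic_basis1.
  - by rewrite -mulr2n !mulr1 mulr_natl.
  - by rewrite subrK subrr dvdz0.
  - by rewrite /m (_ : _ - _ = (2 * N)%N%:Z) ?dvdzz //; lia.
by apply: periodic_basis0; move: (j.+1%:Z) kj => l kl; apply: ndvdz_small; rewrite /m; lia.
Qed.

(** * Real eigenvalues and the extremal trace *)

Hypothesis hspec :
  l2_spectrum (jacobi a b) `<=` [set x%:C | x in `[(-2 : R), 2]].

Lemma jacobi_mx_eigen_real (d : R[i]) (v : 'cV_m) :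
  v != 0 -> J *m v = d *: v -> exists2 x : R, x \in `[-2, 2] & d = x%:C.
Proof.
move=> v0 Jv; have [i vi] : exists i, v i 0 != 0.
  apply/existsP; apply: contra_neqT v0 => /existsPn v0.
  by apply/colP => i; rewrite mxE; apply/eqP; rewrite -[_ == _]negbK.
have [|x xI <-] := @hspec d; last by exists x.
apply: (@periodic_eigen_spectrum _ _ _ (seq_of v) m _ i.+1%:Z) => //.
- exact: periodic_double.
- exact: seq_of_periodic.
- by rewrite seq_of_succ.
- by rewrite -seq_of_J Jv seq_ofZ.
Qed.

Hypothesis hdiag : diagonalizable J.

(* Each of the 2N summands of [tr (T_N(J) S) = 4N (-1)^N] has modulus at most 2,
   hence they are all extremal. *)
Lemma cheb_jacobi_mx :
  cheb (mulmx J) N.-1 1%:M = (-1) ^+ N *: (S *m J).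
Proof.
have [P [d [e [Pu rowJ rowS e2 colJ]]]] := jacobi_shift_eigenbasis hdiag.
have d_real i : exists x : R, (x \in `[-2, 2]) && (d i == x%:C).
  have [|x xI ->] := jacobi_mx_eigen_real _ (colJ i); last by exists x; rewrite xI eqxx.
  apply/eqP => Q0; have : (P *m col i (invmx P)) i 0 = 1.
    by rewrite colE mulmxA mulmxV // mul1mx mxE !eqxx.
  by rewrite Q0 mulmx0 mxE => /esym/eqP; rewrite oner_eq0.
have e_real i : exists s : R, (s ^+ 2 == 1) && (e i == s%:C).
  have := e2 i; move/eqP; rewrite sqrf_eq1 => /orP[] /eqP ->.
    by exists 1; rewrite expr1n !eqxx.
  by exists (-1); rewrite sqrrN expr1n rmorphN !eqxx.
pose x i := xchoose (d_real i); pose s i := xchoose (e_real i).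
have xI i : x i \in `[-2, 2] by have /andP[] := xchooseP (d_real i).
have dE i : d i = (x i)%:C by have /andP[_ /eqP] := xchooseP (d_real i).
have s2 i : s i ^+ 2 = 1 by have /andP[/eqP] := xchooseP (e_real i).
have eE i : e i = (s i)%:C by have /andP[_ /eqP] := xchooseP (e_real i).
have chebC k (y : R) : cheb ( *%R y%:C) k 1 = (cheb ( *%R y) k 1)%:C.
  rewrite (cheb_morph (phi := fun y : R => y%:C) (B := *%R y%:C)) //.
  - by move=> ? ?; rewrite rmorphB.
  - by move=> ?; rewrite rmorphM.
have rowT i k : row i P *m cheb (mulmx J) k 1%:M = (cheb ( *%R (x i)) k 1)%:C *: row i P.
  by rewrite (cheb_row _ (rowJ i)) dE chebC.
(* The sign makes the summands of the trace real numbers at most 2 with sum 2 * 2N. *)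
pose F i := (-1) ^+ N * (cheb ( *%R (x i)) N 1 * s i).
have Fle i : F i <= 2.
  apply: le_trans (ler_norm _) _; rewrite !normrM normrX normrN1 expr1n mul1r.
  have -> : `|s i| = 1.
    by have /eqP := s2 i; rewrite sqrf_eq1 => /orP[] /eqP ->; rewrite ?normrN1 ?normr1.
  by rewrite mulr1 cheb_le2.
have sumF : \sum_i F i = \sum_(i < m) 2.
  pose M := cheb (mulmx J) N 1%:M *m S.
  have trM : \tr M = \sum_i (cheb ( *%R (x i)) N 1 * s i)%:C.
    (* Conjugation by P keeps the trace and turns M into a matrix with diagonal entries T_N(d_i)
       e_i. *)
    rewrite -[M](mulmxKV Pu) mxtrace_mulC mulmxA; apply: eq_bigr => i _.
    transitivity (row i (P *m M *m invmx P) 0 i); first by rewrite !mxE.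
    rewrite !row_mul mulmxA rowT -scalemxAl rowS -!scalemxAl -row_mul mulmxV //.
    by rewrite !mxE eqxx mulr1 eE rmorphM.
  apply: (@complexI R); rewrite -mulr_sumr rmorphM !rmorph_sum -trM cheb_shift_trace.
  rewrite mulr_sumr; apply: eq_bigr => i _.
  by rewrite rmorphXn rmorphN1 mulrCA -expr2 sqrr_sign mulr1 rmorph_nat.
have F2 i : F i = 2.
  (* The differences 2 - F i are nonnegative and sum to 0. *)
  apply/esym/eqP; rewrite -subr_eq0; apply/eqP.
  apply: (psumr_eq0P (P := xpredT) (F := fun i => 2 - F i)) => // [j _|].
    by rewrite subr_ge0.
  by rewrite sumrB sumF subrr.
suff PC : P *m cheb (mulmx J) N.-1 1%:M = P *m ((-1) ^+ N *: (S *m J)).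
  by rewrite -[LHS](mulKmx Pu) PC mulKmx.
apply/row_matrixP => i; rewrite !row_mul rowT -scalemxAr mulmxA rowS -scalemxAl rowJ.
rewrite !scalerA dE eE; congr (_ *: _).
have N1 : N = N.-1.+1 by rewrite prednK.
(* F i = 2 says T_N(x_i) = 2 (-1)^N s_i, the extremal case with sign (-1)^N s_i. *)
rewrite (@cheb_extremal _ (x i) ((-1) ^+ N * s i)) ?rmorphM ?rmorphXn ?rmorphN1 //.
- by rewrite exprMn s2 sqrr_sign mulr1.
- rewrite -N1 -(F2 i) /F.
  transitivity (((-1) ^+ N) ^+ 2 * s i ^+ 2 * cheb ( *%R (x i)) N 1).
    by rewrite sqrr_sign s2 !mul1r.
  by set t := cheb _ _ _; ring.
Qed.

(** * Comparison of coefficients *)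

Lemma cheb_jacobi_periodic (w : int -> R[i]) n : periodic w m%:Z ->
  cheb (jacobi a b) N.-1 w n = (-1) ^+ N * jacobi a b w (n + N%:Z).
Proof.
move=> wm; have -> : w = seq_of (\col_(i < m) w i.+1%:Z).
  apply: (eq_periodic m0) => //; first exact: seq_of_periodic.
  by move=> i; rewrite seq_of_succ mxE.
by rewrite -cheb_mxE cheb_jacobi_mx -scalemxAl seq_ofZ -mulmxA seq_of_S seq_of_J.
Qed.

(* At the site [n - N], the sequence supported on [n + 2N Z] is out of reach of
   T_(N-1)(L). *)
Lemma diagonal_eq0 n : b n = 0.
Proof.
have [j jn] := succ_representative n m0.
have sub k : k - j.+1%:Z = (k - n) + (n - j.+1%:Z) by rewrite addrA subrK.
have e1 : periodic_basis R j n = 1 by exact: periodic_basis1.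
have e0 k : k != n -> `|k - n| < m%:Z -> periodic_basis R j k = 0.
  move=> kn km; apply: periodic_basis0; rewrite sub rpredDr //.
  by apply: ndvdz_small => //; rewrite subr_eq0.
have := cheb_jacobi_periodic (n - N%:Z) (periodic_basis_periodic R j).
rewrite subrK jacobiE e1 (e0 (n + 1)) ?(e0 (n - 1)); try by rewrite /m; lia.
rewrite !mulr0 !add0r mulr1 cheb_jacobi_band => [|k kn]; last by apply: e0; rewrite /m; lia.
(* Even the outermost sites n - 1 and n - 2N + 1 miss the support, so the left side is 0 while the
   right side is (-1)^N b(n). *)
rewrite !e0 ?mulr0 ?addr0; try by rewrite /m; lia.
by move=> /esym/eqP; rewrite mulf_eq0 signr_eq0 => /eqP.
Qed.

(** From l = n - N + 1, T_(N-1)(L) reaches n only by the path to the right, which gives a(l) ...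
    a(n-1) = (-1)^N a(n). Multiplying by a(n) completes a period product, equal to (-1)^N. *)
Lemma offdiagonal_sqr n : a n ^+ 2 = 1.
Proof.
(* For N = 1 the two extreme paths of T_0 end at the same site, so this case is separate: the period
   product itself gives a(n) = -1. *)
have [N1|N2] := leqP N 1.
  have NE : N = 1%N by lia.
  have := prod_period n; rewrite NE big_ord1 addr0 => ->.
  by rewrite expr1 sqrrN expr1n.
have [j jn] := succ_representative n m0.
have sub k : k - j.+1%:Z = (k - n) + (n - j.+1%:Z) by rewrite addrA subrK.
have e1 : periodic_basis R j n = 1 by exact: periodic_basis1.
have e0 k : k != n -> `|k - n| < m%:Z -> periodic_basis R j k = 0.
  move=> kn km; apply: periodic_basis0; rewrite sub rpredDr //.
  by apply: ndvdz_small => //; rewrite subr_eq0.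
pose l := n - N%:Z + 1.
have := cheb_jacobi_periodic l (periodic_basis_periodic R j).
rewrite jacobiE (_ : l + N%:Z = n + 1); last by rewrite /l; lia.
rewrite addrK e1 (e0 (n + 1)) ?(e0 (n + 1 + 1)); try by rewrite /m; lia.
rewrite cheb_jacobi_band => [|k kl]; last by apply: e0; move: kl; rewrite /m /l; lia.
rewrite (_ : l + N.-1%:Z = n) ?e1 ?e0; try by rewrite /m /l; lia.
rewrite !mulr0 add0r !addr0 !mulr1 => h.
have := prod_period l; rewrite -(big_mkord xpredT (fun j => a (l + j%:Z))).
rewrite -[X in index_iota _ X](prednK hN) big_nat_recr //= big_mkord h.
rewrite (_ : l + N.-1%:Z = n); last by rewrite /l; lia.
rewrite -mulrA -expr2 -{2}[(-1) ^+ N]mulr1 => /mulfI; apply.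
by rewrite signr_eq0.
Qed.

End Eigenbasis.

Theorem theorem5 (R : realType) (N : nat) (a b : int -> R[i])
  (hN : (1 <= N)%N)
  (ha : periodic a N%:Z) (hb : periodic b N%:Z)
  (ha0 : forall n : int, a n != 0)
  (hprod : \prod_(1 <= j < N.+1) a j%:Z = (-1) ^+ N)
  (hspec : l2_spectrum (jacobi a b) = [set x%:C | x in `[(-2 : R), 2]])
  (hdiag : diagonalizable (jacobi_periodic_mx a b (2 * N))) :
  (odd N -> forall n : int, b n = 0 /\ a n ^+ 2 = 1) /\
  (forall M : nat, N = (2 * M)%N ->
     (forall n : int, b n = 0) /\
     exists s : R[i],
       (forall n : int, a n ^+ 2 = 1 + (-1) ^ n * s) /\
       exists2 k : nat, (k < M)%N &
         s ^+ 2 = 1 - cexp (2 * k%:R * pi%:C * 'i%C / M%:R)).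
Proof.
have hsub : l2_spectrum (jacobi a b) `<=` [set x%:C | x in `[(-2 : R), 2]].
  by rewrite hspec.
have b0 : forall n, b n = 0 by exact: (diagonal_eq0 hN ha hb ha0 hprod hsub hdiag).
have a1 : forall n, a n ^+ 2 = 1 by exact: (offdiagonal_sqr hN ha hb ha0 hprod hsub hdiag).
split=> [_ n|M NM]; first by rewrite b0 a1.
split=> //; exists 0; split=> [n|]; first by rewrite mulr0 addr0.
(* Here 0 < M follows from N = 2M and N >= 1; the exponential at k = 0 equals 1, matching s = 0. *)
exists 0%N; first by lia.
rewrite mulr0 !mul0r /cexp /= expR0 cos0 sin0 mulr1 expr0n.
by rewrite subrr.
Qed.
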